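(* Let $W$ be a finite Coxeter group and let $\sqsubseteq$ be the cutting relation on $W$. Then: (1) $(W,\sqsubseteq)$ is a meet-distributive meet-semilattice with $1$ as minimal element, and it is a subposet of both $(W,\le_L)$ and $(W,\le_R)$. (2) Every interval of $(W,\sqsubseteq)$ is a distributive sublattice of $(W,\sqsubseteq)$, and a sublattice of both $(W,\le_L)$ and $(W,\le_R)$. (3) Let $w\in W$, let $\operatorname{Pred}(w)$ be the set of lower covers of $w$ in $(W,\sqsubseteq)$, and let $L_w$ be the meet-semilattice generated by $\operatorname{Pred}(w)$ using the meet $\wedge_{\sqsubseteq}$ (equivalently, using the meet $\wedge_L$ or $\wedge_R$ of left or right order), the empty meet being $w$. Then $L_w$ is free, that is, isomorphic to a Boolean lattice. (4) The Möbius function $\mu$ of $(W,\sqsubseteq)$ is given, for $u\sqsubseteq w$, by $\mu(u,w)=(-1)^{r(u,w)}$ if $u\in L_w$ and $\mu(u,w)=0$ otherwise, where $r(u,w):=|\{v\in\operatorname{Pred}(w)\mid u\sqsubseteq v\}|$.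
   Context: $W=\langle s_i\mid i\in I\rangle$ is a finite Coxeter group with simple reflections $s_i$, identity $1$ and length function $\ell$. For $J\subseteq I$, $W_J=\langle s_j\mid j\in J\rangle$. Right weak order: $u\le_R w$ iff $\ell(w)=\ell(u)+\ell(u^{-1}w)$. Left weak order: $u\le_L w$ iff $\ell(w)=\ell(u)+\ell(wu^{-1})$. Both are lattices. For $K\subseteq I$, each $w\in W$ factors uniquely as $w=w^K\,{}_Kw$ with ${}_Kw\in W_K$ and $w^K$ having no right descent in $K$ (i.e. $\ell(w^Ks_k)>\ell(w^K)$ for all $k\in K$). A subset $K\subseteq I$ is a right block of $w$ if there exists $J\subseteq I$ with $W_Jw=wW_K$. The cutting relation is: $v\sqsubseteq w$ iff $v=w^K$ for some right block $K$ of $w$. A poset $(P,\preceq)$ is a subposet of $(P,\le)$ here if $x\preceq y$ implies $x\le y$. A (finite) meet-semilattice is meet-distributive if for every element $y$, if $x$ is the meet of the elements covered by $y$, then the interval $[x,y]$ is a Boolean algebra (for $y$ minimal, $x=y$). The Möbius function of a poset is defined by $\mu(x,x)=1$ and $\mu(x,y)=-\sum_{x\preceq z\prec y}\mu(x,z)$ for $x\prec y$. *)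

(* Defs.v *)
From HB Require Import structures.
From mathcomp Require Import all_boot all_order all_algebra all_fingroup.

Set Implicit Arguments.
Unset Strict Implicit.
Unset Printing Implicit Defensive.

Import Order.TTheory GRing.Theory.

(* Order theory of a relation on a finite type. The relations studied here all
   live on one carrier, so orders are plain relations rather than instances. *)
Section FiniteRelations.

Variables (T : finType) (r : rel T).

Definition partial_order : Prop :=
  [/\ reflexive r, antisymmetric r & transitive r].

Definition is_inf (A : {set T}) (m : T) : bool :=
  [forall x in A, r m x] && [forall z, [forall x in A, r z x] ==> r z m].

Definition is_sup (A : {set T}) (j : T) : bool :=
  [forall x in A, r x j] && [forall z, [forall x in A, r x z] ==> r j z].

Definition meet_semilattice : Prop :=
  partial_order /\ forall x y, exists m, is_inf [set x; y] m.

Definition order_interval (x y : T) : {set T} := [set z | r x z && r z y].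

Definition lower_covers (y : T) : {set T} :=
  [set x | [&& r x y, x != y &
    [forall z, r x z && r z y ==> (z == x) || (z == y)]]].

(* The meet of a set of elements below [top], the empty meet being [top]. *)
Definition is_capped_inf (top : T) (A : {set T}) (m : T) : bool :=
  if A == set0 then m == top else is_inf A m.

Definition meet_span (top : T) (P : {set T}) : {set T} :=
  [set m | [exists A : {set T}, (A \subset P) && is_capped_inf top A m]].

(* The meet-semilattice spanned by P is the free one: the subsets of P, ordered
   by reverse inclusion, embed into it through their meets. *)
Definition free_meets (top : T) (P : {set T}) : Prop :=
  forall (A B : {set T}) (a b : T), A \subset P -> B \subset P ->
    is_capped_inf top A a -> is_capped_inf top B b -> r a b = (B \subset A).

Definition order_iso_to (X : {set T}) d (B : porderType d) : Prop :=
  exists f : B -> T, [/\ forall b, f b \in X,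
    forall x, x \in X -> exists b, f b = x & {mono f : b c / (b <= c)%O >-> r b c}].

Definition distributive_lattice_on (X : {set T}) : Prop :=
  exists (d : Order.disp_t) (B : distrLatticeType d), order_iso_to X B.

(* [ctbDistrLatticeType] is the structure of Boolean algebras. *)
Definition boolean_lattice_on (X : {set T}) : Prop :=
  exists (d : Order.disp_t) (B : ctbDistrLatticeType d), order_iso_to X B.

Definition meet_distributive : Prop :=
  forall x y, is_capped_inf y (lower_covers y) x ->
    boolean_lattice_on (order_interval x y).

(* Any two elements of X have a meet and a join in the whole of (T, r), and
   these belong to X. *)
Definition meet_join_closed (X : {set T}) : Prop :=
  forall x y, x \in X -> y \in X ->
    (exists2 m, m \in X & is_inf [set x; y] m) /\
    (exists2 j, j \in X & is_sup [set x; y] j).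

(* The recursion is on the length of chains from x up to y, which is at most
   #|T|; see [moebius_refl] and [moebius_rec] below. *)
Fixpoint moebius_fuel (n : nat) (x y : T) : int :=
  if n is n'.+1 then
    if x == y then 1%R
    else (- \sum_(z | [&& r x z, r z y & z != y]) moebius_fuel n' x z)%R
  else 0%R.

Definition moebius (x y : T) : int := moebius_fuel #|T|.+1 x y.

Lemma moebius_refl x : moebius x x = 1%R.
Proof. by rewrite /moebius /= eqxx. Qed.

Lemma moebius_rec x y : partial_order -> r x y -> x != y ->
  moebius x y = (- \sum_(z | [&& r x z, r z y & z != y]) moebius x z)%R.
Proof.
case=> rr ra rt rxy nxy.
have stable: forall n m z, #|order_interval x z| < n -> #|order_interval x z| < m ->
    moebius_fuel n x z = moebius_fuel m x z.
  elim=> [|n IHn] [|m] z //= ltn ltm; case: eqP => // _.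
  congr (- _)%R; apply: eq_bigr => t /and3P[rxt rtz ntz].
  have lt_tz: #|order_interval x t| < #|order_interval x z|.
    apply: proper_card; apply/properP; split.
      by apply/subsetP=> v; rewrite !inE => /andP[-> rvt] /=; apply: rt rtz.
    exists z; rewrite !inE ?rr ?(rt _ _ _ rxt rtz) //=.
    by apply: contra ntz => rzt; apply/eqP/ra; rewrite rtz rzt.
  by apply: IHn; [apply: leq_trans lt_tz _ | apply: leq_trans lt_tz _].
rewrite {1}/moebius /= (negPf nxy); congr (- _)%R.
apply: eq_bigr => z /and3P[rxz rzy nzy].
apply: stable; last by rewrite ltnS max_card.
rewrite -cardsT; apply: proper_card; apply/properP; split; first exact: subsetT.
exists y; rewrite ?inE // rxy /=.
by apply: contra nzy => ryz; apply/eqP/ra; rewrite rzy ryz.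
Qed.

End FiniteRelations.

(* (X, q) is a sublattice of (T, r): q and r agree on X, and X is stable under
   the meets and joins of (T, r). *)
Definition sublattice (T : finType) (q r : rel T) (X : {set T}) : Prop :=
  {in X &, forall x y, q x y = r x y} /\ meet_join_closed r X.

Local Open Scope group_scope.

(* A Coxeter system in the sense of Bourbaki: distinct generators of order 2,
   and a presentation by the relations (s_i s_j)^m_ij = 1 with m_ij the order
   of s_i s_j. The presentation is stated as a universal property; uniqueness
   of the morphism follows from generation. *)
Definition coxeter_system (gT : finGroupType) (I : finType) (s : I -> gT) : Prop :=
  [/\ injective s, forall i, #[s i] = 2, <<[set s i | i : I]>> = [set: gT] &
    forall (H : groupType) (t : I -> H),
      (forall i j, (t i * t j) ^+ #[s i * s j] = 1) ->
      exists2 f : gT -> H, {morph f : x y / x * y} & forall i, f (s i) = t i].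

Section Coxeter.

Variables (gT : finGroupType) (I : finType) (s : I -> gT).

Implicit Types (J K : {set I}) (u v w : gT).

Definition has_word (w : gT) (n : nat) : bool :=
  [exists t : n.-tuple I, \prod_(i <- t) s i == w].

(* The least length of a word for w; it is below #|gT| when the generators
   generate, see [coxeter_length_has_word] and [coxeter_length_min]. *)
Definition coxeter_length (w : gT) : nat := find (has_word w) (iota 0 #|gT|).

Definition parabolic (J : {set I}) : {set gT} := <<[set s j | j in J]>>.

Definition weakR (u w : gT) : bool :=
  coxeter_length w == (coxeter_length u + coxeter_length (u^-1 * w))%N.

Definition weakL (u w : gT) : bool :=
  coxeter_length w == (coxeter_length u + coxeter_length (w * u^-1))%N.

Definition no_right_descent (K : {set I}) (v : gT) : bool :=
  [forall k in K, coxeter_length v < coxeter_length (v * s k)].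

(* v = w^K, that is w = v x with x in W_K and v without right descent in K. *)
Definition is_upper_factor (K : {set I}) (w v : gT) : bool :=
  [exists x in parabolic K, w == v * x] && no_right_descent K v.

Definition right_block (w : gT) (K : {set I}) : bool :=
  [exists J : {set I}, parabolic J :* w == w *: parabolic K].

Definition cutting (v w : gT) : bool :=
  [exists K : {set I}, right_block w K && is_upper_factor K w v].

Lemma coxeter_length_has_word w : <<[set s i | i : I]>> = [set: gT] ->
  has_word w (coxeter_length w).
Proof.
move=> gen.
have [n0 wn0]: exists n, has_word w n.
  have /gen_prodgP[n [c sc ->]] : w \in <<[set s i | i : I]>> by rewrite gen inE.
  have /fin_all_exists[e ec] : forall k, exists i, c k = s i.
    by move=> k; have /imsetP[i _ ->] := sc k; exists i.
  exists n; apply/existsP; exists [tuple e k | k < n].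
  rewrite big_map val_ord_tuple enumT [index_enum _]unlock; apply/eqP.
  by apply: eq_bigr => k _; rewrite ec.
have exw : exists n, has_word w n by exists n0.
case: (ex_minnP exw) => m wm minm.
have lt_m : m < #|gT|.
  case/existsP: wm => t /eqP def_w.
  pose p (k : 'I_m.+1) := \prod_(i <- take k t) s i.
  have p_inj : injective p.
    have aux : forall j k : 'I_m.+1, j < k -> p j <> p k.
      move=> j k lt_jk eq_p.
      have szt : size (take j t ++ drop k t) = (j + (m - k))%N.
        rewrite size_cat size_drop size_takel size_tuple //.
        exact: ltn_ord j.
      have /minm : has_word w (j + (m - k))%N.
        rewrite -szt; apply/existsP; exists (in_tuple (take j t ++ drop k t)).
        by rewrite /= big_cat /= [X in X * _]eq_p /p -big_cat cat_take_drop def_w.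
      have le_km : k <= m by exact: ltn_ord k.
      by rewrite leqNgt -[X in _ < X](subnKC le_km) ltn_add2r lt_jk.
    move=> j k eq_p; apply/eqP; apply: contraT; rewrite -val_eqE neq_ltn /=.
    by case/orP=> /aux; rewrite eq_p.
  by rewrite -[m.+1]card_ord -(card_codom p_inj) max_card.
have hw : has (has_word w) (iota 0 #|gT|).
  by apply/hasP; exists m; rewrite ?mem_iota.
have := nth_find 0 hw; rewrite nth_iota ?add0n //.
by move: hw; rewrite has_find size_iota.
Qed.

Lemma coxeter_length_min w n : has_word w n -> coxeter_length w <= n.
Proof.
move=> wn; rewrite leqNgt; apply/negP => lt_n.
have lt_n' : n < #|gT|.
  by apply: leq_trans lt_n _; rewrite -[X in _ <= X](size_iota 0) find_size.
by have := before_find 0 lt_n; rewrite nth_iota // add0n wn.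
Qed.

End Coxeter.

(* Main.v *)
Require Import Defs.
From HB Require Import structures.
From mathcomp Require Import all_boot all_order all_algebra all_fingroup.

Set Implicit Arguments.
Unset Strict Implicit.
Unset Printing Implicit Defensive.

Import Order.TTheory Order.SetSubsetOrder.Exports GRing.Theory.

(* Let N(v) be the set of k such that v s_k > v and v s_k v^-1 is simple. Then
   v is below w for cutting iff v^-1 w lies in W_N(v), and N is decreasing,
   which gives transitivity. If W_J w = w W_K, then the left inversion set of
   w^K is that of w with W_J removed. Since the pairs (J, K) with this property
   are closed under componentwise union and intersection, and W_J :&: W_J' is
   W_(J :&: J'), this identifies w^(K :|: K') and w^(K :&: K') with the meet and
   the join of w^K and w^K', in right order as well as for cutting. So the
   elements below w form a distributive lattice, a quotient of the dual of the
   lattice of right blocks of w. As joins of bounded pairs are computed in right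
   order, they do not depend on the bound, and meets exist globally. The claims
   on Pred(w) and on the Moebius function then hold in any meet-semilattice
   whose principal ideals are distributive lattices. *)

(** * Meet-semilattices with distributive principal ideals *)

Section InfSup.

Variables (T : finType) (r : rel T).
Implicit Types (A : {set T}) (u v w x y z m : T).

Lemma is_infP A m :
  reflect ((forall x, x \in A -> r m x) /\
           forall z, (forall x, x \in A -> r z x) -> r z m) (is_inf r A m).
Proof.
apply: (iffP andP) => [[/forall_inP lbm /forall_inP glb]|[lbm glb]].
  by split=> // z lbz; apply: glb; apply/forall_inP.
by split; apply/forall_inP => // z /forall_inP; apply: glb.
Qed.

Lemma is_inf2P x y m :
  reflect [/\ r m x, r m y & forall z, r z x -> r z y -> r z m]
    (is_inf r [set x; y] m).
Proof.
apply: (iffP (is_infP _ _)) => [[lbm glb]|[rmx rmy glb]].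
  by split=> [||z rzx rzy]; rewrite ?lbm ?set21 ?set22 // glb // => t /set2P[] ->.
by split=> [t /set2P[] -> //|z lbz]; apply: glb; rewrite lbz ?set21 ?set22.
Qed.

Lemma is_sup2P x y j :
  reflect [/\ r x j, r y j & forall z, r x z -> r y z -> r j z]
    (is_sup r [set x; y] j).
Proof.
apply: (iffP andP) => [[/forall_inP ubj /forall_inP lub]|[rxj ryj lub]].
  split=> [||z rxz ryz]; rewrite ?ubj ?set21 ?set22 //.
  by apply: lub; apply/forall_inP=> t /set2P[] ->.
split; first by apply/forall_inP=> t /set2P[] ->.
by apply/forall_inP=> z /forall_inP ubz; apply: lub; rewrite ubz ?set21 ?set22.
Qed.

Hypothesis rP : partial_order r.

Lemma is_inf_unique A m n : is_inf r A m -> is_inf r A n -> m = n.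
Proof.
case: rP => _ ra _ /is_infP[lbm glbm] /is_infP[lbn glbn].
by apply: ra; rewrite glbn // glbm.
Qed.

Lemma is_sup2_unique x y j k :
  is_sup r [set x; y] j -> is_sup r [set x; y] k -> j = k.
Proof.
case: rP => _ ra _ /is_sup2P[xj yj lubj] /is_sup2P[xk yk lubk].
by apply: ra; rewrite lubj ?lubk.
Qed.

(** Since [w] bounds [A], adding it leaves a nonempty infimum unchanged and turns the convention on
    the empty meet into the case of [[set w]]. *)
Lemma is_capped_infE w A m : {in A, forall x, r x w} ->
  is_capped_inf r w A m = is_inf r (w |: A) m.
Proof.
case: rP => rr ra rt leAw; rewrite /is_capped_inf; have [->|/set0Pn[a aA]] := eqVneq.
  rewrite setU0; apply/eqP/is_infP => [->|[lbm glb]].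
    by split=> [x /set1P->|z] //; apply; rewrite set11.
  by apply: ra; rewrite lbm ?set11 // glb // => x /set1P->.
apply/is_infP/is_infP => -[lbm glb]; split.
- by move=> x /setU1P[->|/lbm//]; apply: rt (lbm a aA) (leAw a aA).
- by move=> z lbz; apply: glb => x xA; rewrite lbz // setU1r.
- by move=> x xA; rewrite lbm // setU1r.
move=> z lbz; apply: glb => x /setU1P[->|/lbz//].
by apply: rt (lbz a aA) (leAw a aA).
Qed.

(* Bounded joins suffice: the common lower bounds of two elements are closed
   under joins, hence have a greatest element. *)
Lemma bounded_sups_infs bot : (forall x, r bot x) ->
    (forall u v w, r u w -> r v w -> exists j, is_sup r [set u; v] j) ->
  forall x y, exists m, is_inf r [set x; y] m.
Proof.
case: rP => rr ra rt bot_le sups x y.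
pose C z := r z x && r z y.
have Cbot : C bot by rewrite /C !bot_le.
(* Down-sets grow strictly along [r], so a common lower bound with the largest down-set is maximal;
   joining it with another one cannot enlarge it. *)
case: (arg_maxnP (fun z => #|[set t | r t z]|) Cbot) => m /andP[mx my] maxm.
exists m; apply/is_inf2P; split=> // z zx zy.
have [j /is_sup2P[mj zj lubj]] := sups m z x mx zx.
have Cj : C j by rewrite /C !lubj.
have sub : [set t | r t m] \subset [set t | r t j].
  by apply/subsetP=> t; rewrite !inE => /rt; apply.
have /eqP eqmj : [set t | r t m] == [set t | r t j] by rewrite eqEcard sub; apply: maxm.
have : j \in [set t | r t m] by rewrite eqmj inE rr.
by rewrite inE; apply: rt.
Qed.

End InfSup.

Section LocallyDistributive.

Variables (T : finType) (r : rel T) (meet join : T -> T -> T).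
Implicit Types (A B X : {set T}) (u v w x y z m : T).

(** [join] is constrained only on bounded pairs, and distributivity only below a common [w]. The
    first law makes the intervals distributive lattices; the second lets a join act on each factor
    of a meet of coatoms. *)
Definition locally_distributive : Prop :=
  [/\ partial_order r,
      forall x y, is_inf r [set x; y] (meet x y),
      forall x y w, r x w -> r y w -> is_sup r [set x; y] (join x y),
      forall x y z w, r x w -> r y w -> r z w ->
        meet x (join y z) = join (meet x y) (meet x z) &
      forall x y z w, r x w -> r y w -> r z w ->
        join x (meet y z) = meet (join x y) (join x z)].

Hypothesis ldT : locally_distributive.

Let rP : partial_order r. Proof. by case: ldT. Qed.
Let rr : reflexive r. Proof. by case: rP. Qed.
Let ra : antisymmetric r. Proof. by case: rP. Qed.
Let rt : transitive r. Proof. by case: rP. Qed.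
Let req x y : r x y -> r y x -> x = y. Proof. by move=> xy yx; apply: ra; rewrite xy. Qed.
(** An element is determined by its lower set, which reduces lattice identities to identities
    between conjunctions. *)
Let eq_lower x y : (forall z, r z x = r z y) -> x = y.
Proof. by move=> exy; apply: req; [rewrite -exy | rewrite exy]. Qed.
Let eq_upper x y : (forall z, r x z = r y z) -> x = y.
Proof. by move=> exy; apply: req; [rewrite exy | rewrite -exy]. Qed.
Let meet_inf x y : is_inf r [set x; y] (meet x y). Proof. by case: ldT. Qed.
Let join_sup x y w : r x w -> r y w -> is_sup r [set x; y] (join x y).
Proof. by case: ldT => _ _ + _ _; apply. Qed.

Let le_meet z x y : r z (meet x y) = r z x && r z y.
Proof.
have /is_inf2P[mx my glb] := meet_inf x y.
apply/idP/andP=> [zm|[zx zy]]; last exact: glb.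
by rewrite (rt zm mx) (rt zm my).
Qed.

Let meet_l x y : r (meet x y) x. Proof. by have /is_inf2P[] := meet_inf x y. Qed.
Let meet_r x y : r (meet x y) y. Proof. by have /is_inf2P[] := meet_inf x y. Qed.

Let le_join x y z w : r x w -> r y w -> r (join x y) z = r x z && r y z.
Proof.
move=> xw yw; have /is_sup2P[xj yj lub] := join_sup xw yw.
apply/idP/andP=> [jz|[xz yz]]; last exact: lub.
by rewrite (rt xj jz) (rt yj jz).
Qed.

Let join_l x y w : r x w -> r y w -> r x (join x y).
Proof. by move=> xw yw; have /is_sup2P[] := join_sup xw yw. Qed.
Let join_r x y w : r x w -> r y w -> r y (join x y).
Proof. by move=> xw yw; have /is_sup2P[] := join_sup xw yw. Qed.
Let join_le x y w : r x w -> r y w -> r (join x y) w.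
Proof. by move=> xw yw; rewrite (le_join _ xw yw) xw. Qed.

Lemma meet_join_closed_interval u w : meet_join_closed r (order_interval r u w).
Proof.
move=> x y; rewrite !inE => /andP[ux xw] /andP[uy yw]; split.
  exists (meet x y); last exact: meet_inf.
  by rewrite inE le_meet ux uy (rt (meet_l x y) xw).
exists (join x y); last exact: join_sup xw yw.
by rewrite inE (join_le xw yw) (rt ux (join_l xw yw)).
Qed.

(** * Lattice structure on bounded subsets closed under [meet] and [join] *)

Section IntervalLattice.

Variables (X : {set T}) (w : T).
Hypothesis leXw : {in X, forall x, r x w}.
Hypothesis meetX : {in X &, forall x y, meet x y \in X}.
Hypothesis joinX : {in X &, forall x y, join x y \in X}.

Local Notation sub_interval := {x | x \in X}.
Implicit Types a b c : sub_interval.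

Let sub_le a b := r (val a) (val b).
Let sub_lt a b := (b != a) && sub_le a b.
Let sub_meet a b : sub_interval := Sub (meet (val a) (val b)) (meetX (valP a) (valP b)).
Let sub_join a b : sub_interval := Sub (join (val a) (val b)) (joinX (valP a) (valP b)).

Let lew a : r (val a) w. Proof. exact: leXw (valP a). Qed.

Let le_defE a b : sub_le a b = (sub_meet a b == a).
Proof.
rewrite -val_eqE SubK /sub_le; apply/idP/eqP => [ab|<-]; last exact: meet_r.
by apply: req; rewrite ?meet_l // le_meet rr.
Qed.

Let meet_comm x y : meet x y = meet y x.
Proof. by apply: eq_lower => z; rewrite !le_meet andbC. Qed.

Let join_comm x y : r x w -> r y w -> join x y = join y x.
Proof.
by move=> xw yw; apply: eq_upper => z; rewrite (le_join _ xw yw) (le_join _ yw xw) andbC.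
Qed.

Lemma distributive_lattice_on_closed : distributive_lattice_on r X.
Proof.
have meetC' : commutative sub_meet by move=> a b; apply: val_inj; apply: meet_comm.
have joinC' : commutative sub_join by move=> a b; apply: val_inj; apply: join_comm.
have meetA' : associative sub_meet.
  by move=> a b c; apply/val_inj/eq_lower => z; rewrite !le_meet andbA.
have jw a b : r (join (val a) (val b)) w by apply: join_le.
have joinA' : associative sub_join.
  move=> a b c; apply/val_inj/eq_upper => z /=.
  rewrite (le_join _ (lew a) (jw b c)) (le_join _ (jw a b) (lew c)).
  by rewrite (le_join _ (lew b) (lew c)) (le_join _ (lew a) (lew b)) andbA.
have joinKI' b a : sub_meet a (sub_join a b) = a.
  apply: val_inj; apply: req => /=; rewrite ?meet_l // le_meet rr.
  exact: join_l (lew a) (lew b).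
have meetKU' b a : sub_join a (sub_meet a b) = a.
  have mw : r (meet (val a) (val b)) w by exact: rt (meet_l _ _) (lew a).
  apply: val_inj; apply: req => /=; last exact: join_l (lew a) mw.
  by rewrite (le_join _ (lew a) mw) rr meet_l.
have meetUl' : left_distributive sub_meet sub_join.
  move=> a b c; apply: val_inj; case: ldT => _ _ _ dist _.
  rewrite /sub_meet /sub_join !SubK [LHS]meet_comm (dist _ _ _ w) //.
  by rewrite [meet (val c) (val a)]meet_comm [meet (val c) (val b)]meet_comm.
have meetxx' : idempotent_op sub_meet.
  by move=> a; apply: val_inj; apply: req; rewrite /= ?meet_l // le_meet rr.
pose M := @Order.isMeetJoinDistrLattice.Build (Order.Disp tt tt) sub_interval
  sub_le sub_lt sub_meet sub_join le_defE (fun _ _ => erefl)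
  meetC' joinC' meetA' joinA' joinKI' meetKU' meetUl' meetxx'.
pose B : distrLatticeType _ := HB.pack sub_interval M.
exists (Order.Disp tt tt), B, val; split=> [b|x xX|//]; first exact: valP.
by exists (Sub x xX : sub_interval).
Qed.

End IntervalLattice.

Lemma distributive_lattice_on_interval u w :
  distributive_lattice_on r (order_interval r u w).
Proof.
apply: (@distributive_lattice_on_closed _ w) => [x|x y|x y]; rewrite !inE.
- by case/andP.
- by move=> /andP[ux xw] /andP[uy _]; rewrite le_meet ux uy (rt (meet_l x y) xw).
move=> /andP[ux xw] /andP[uy yw].
by rewrite (join_le xw yw) (rt ux (join_l xw yw)).
Qed.

(** * Meets of coatoms and the Moebius function *)

Section Coatoms.

Variable w : T.
Let P := lower_covers r w.

Definition big_meet A : T := \big[meet/w]_(x in A) x.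

Lemma le_big_meet z A : r z (big_meet A) = r z w && [forall x in A, r z x].
Proof.
(* [w] is neutral for [meet] only below [w], so [meet] is not a monoid law with unit [w]; the
   induction runs over the enumeration. *)
have le_seq (s : seq T) : r z (\big[meet/w]_(x <- s | x \in A) x)
    = r z w && all (fun x => (x \in A) ==> r z x) s.
  elim: s => [|x s IHs]; first by rewrite big_nil andbT.
  by rewrite big_cons /=; case: (x \in A); rewrite //= le_meet IHs andbCA.
rewrite /big_meet le_seq; congr (_ && _).
apply/allP/forall_inP => [h x xA|h x _]; last by apply/implyP/h.
by apply: (implyP (h x _)); rewrite ?mem_index_enum.
Qed.

Lemma big_meet_capped_inf A : {in A, forall x, r x w} ->
  is_capped_inf r w A (big_meet A).
Proof.
move=> leAw; rewrite is_capped_infE //; apply/is_infP; split=> [x|z lbz].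
  have := rr (big_meet A); rewrite {1}le_big_meet => /andP[mw /forall_inP mA].
  by case/setU1P=> [->|/mA].
rewrite le_big_meet lbz ?setU11 //=; apply/forall_inP => x xA.
by rewrite lbz // setU1r.
Qed.

Lemma coversP v : reflect [/\ r v w, v != w &
  forall z, r v z -> r z w -> z = v \/ z = w] (v \in P).
Proof.
rewrite inE; apply: (iffP and3P) => -[vw nvw cov]; split=> //.
  move=> z vz zw; have := implyP (forallP cov z); rewrite vz zw.
  by case/(_ isT)/orP=> /eqP; auto.
apply/forallP=> z; apply/implyP=> /andP[vz zw]; apply/orP.
by case: (cov z vz zw) => ->; auto.
Qed.

Let leP v : v \in P -> r v w. Proof. by case/coversP. Qed.

(* Joining with u sends a coatom x to x or to the top w, according to whether
   u lies below x; both freeness and the description of intervals follow. *)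
Lemma join_big_meet u A : r u w -> A \subset P ->
  join u (big_meet A) = big_meet [set x in A | r u x].
Proof.
move=> uw /subsetP sAP.
have joinA x : x \in A -> join u x = if r u x then x else w.
  move=> /sAP/coversP[xw nxw cov]; case: ifP => ux.
    by apply: req; rewrite ?(join_r uw xw) // (le_join _ uw xw) ux rr.
  case: (cov _ (join_r uw xw) (join_le uw xw)) => // eqx.
  by have := join_l uw xw; rewrite eqx ux.
rewrite /big_meet [RHS](eq_bigl (fun x => (x \in A) && r u x)); last first.
  by move=> x; rewrite inE.
elim: (index_enum T) => [|x e IHe].
  by rewrite !big_nil; apply: req; rewrite ?(join_le uw) // (join_r uw).
have le_w (Q : pred T) : (forall y, Q y -> y \in A) ->
    r (\big[meet/w]_(y <- e | Q y) y) w.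
  move=> QA; elim/big_ind: _ => // [y z yw _|y /QA/sAP/leP //].
  exact: rt (meet_l _ _) yw.
rewrite !big_cons; case: ifP => //= xA; have xw := leP (sAP x xA).
(* Distributivity splits off the factor [x]: [join u x] is [x] or [w], and a factor [w] is absorbed
   since the remaining meet lies below [w]. *)
have [_ _ _ _ joinI] := ldT; rewrite (joinI _ _ _ w uw xw) ?IHe ?joinA ?le_w //.
case: ifP => // ux; apply: req; rewrite ?meet_r // le_meet rr andbT.
by apply: le_w => y /andP[].
Qed.

(** If [v] is above the meet of [A] but not in [A], then joining that meet with [v] gives [v]; by
    [join_big_meet] it also gives the meet of the elements of [A] above [v]. Coatoms being
    incomparable, this is the empty meet [w], a contradiction. *)
Lemma big_meet_le_coatom A v : A \subset P -> v \in P ->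
  r (big_meet A) v = (v \in A).
Proof.
move=> sAP vP; have [vw nvw cov] := coversP _ vP.
apply/idP/idP=> [mv|vA]; last first.
  by have := rr (big_meet A); rewrite {1}le_big_meet => /andP[_ /forall_inP->].
have mw : r (big_meet A) w := rt mv vw.
apply: contraNT nvw => nvA; apply/eqP.
rewrite -(_ : join v (big_meet A) = v); last first.
  by apply: req; rewrite ?(join_l vw mw) // (le_join _ vw mw) rr mv.
rewrite join_big_meet // (_ : [set x in A | r v x] = set0) ?[LHS]big_set0 //.
apply/setP=> x; rewrite !inE; apply/negP=> /andP[xA vx].
have [xw nxw _] := coversP _ (subsetP sAP x xA).
case: (cov x vx xw) => eqx; first by rewrite -eqx xA in nvA.
by rewrite eqx eqxx in nxw.
Qed.

Let le_coatoms A : A \subset P -> {in A, forall x, r x w}.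
Proof. by move=> /subsetP sAP x /sAP/leP. Qed.

Lemma capped_inf_coatoms A a : A \subset P ->
  is_capped_inf r w A a = (a == big_meet A).
Proof.
move=> /le_coatoms leA; apply/idP/eqP=> [infa|->]; last exact: big_meet_capped_inf.
have := big_meet_capped_inf leA; rewrite is_capped_infE // => infm.
by move: infa; rewrite is_capped_infE // => /is_inf_unique; apply.
Qed.

Lemma meet_span_coatoms : meet_span r w P = [set big_meet A | A in powerset P].
Proof.
apply/setP=> m; rewrite inE; apply/existsP/imsetP=> [[A /andP[sAP]]|[A + ->]].
  by rewrite capped_inf_coatoms // => /eqP->; exists A; rewrite // inE.
by rewrite inE => sAP; exists A; rewrite sAP capped_inf_coatoms /=.
Qed.

Let le_big_meets A B : A \subset P -> B \subset P ->
  r (big_meet A) (big_meet B) = (B \subset A).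
Proof.
move=> sAP sBP; rewrite le_big_meet.
have -> : r (big_meet A) w.
  by have := rr (big_meet A); rewrite {1}le_big_meet => /andP[].
apply/forall_inP/subsetP => sBA x xB.
  by rewrite -big_meet_le_coatom ?sBA ?(subsetP sBP).
by rewrite big_meet_le_coatom ?sBA ?(subsetP sBP).
Qed.

Lemma free_meets_coatoms : free_meets r w P.
Proof.
move=> A B a b sAP sBP; rewrite !capped_inf_coatoms // => /eqP-> /eqP->.
exact: le_big_meets.
Qed.

Lemma boolean_meet_span_coatoms : boolean_lattice_on r (meet_span r w P).
Proof.
(* Meets reverse the inclusion of sets of coatoms, hence the complement. *)
pose F (A : {set {v | v \in P}}) := big_meet (P :\: [set val v | v in A]).
exists Order.SetSubsetOrder.subset_display, (Order.SetSubsetOrder.type _ {v | v \in P}), F.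
split=> [A|x|A B].
- by rewrite meet_span_coatoms; apply: imset_f; rewrite inE subsetDl.
- rewrite meet_span_coatoms => /imsetP[A]; rewrite inE => /subsetP sAP ->.
  exists [set v | val v \notin A]; congr big_meet; apply/setP=> y; rewrite inE.
  apply/andP/idP=> [[nyI yP]|yA]; last first.
    split; last exact: sAP.
    by apply/imsetP=> -[v]; rewrite inE => nvA eqy; rewrite -eqy yA in nvA.
  by apply: contraNT nyI => nyA; apply/imsetP; exists (Sub y yP); rewrite ?inE SubK.
rewrite le_big_meets ?subsetDl // Order.SetSubsetOrder.leEsubset.
apply/subsetP/subsetP => sub v.
  move=> vA; apply: contraT => nvB; have := sub (val v).
  by rewrite !in_setD !(mem_imset _ _ val_inj) vA nvB (valP v) => /(_ isT).
rewrite !in_setD => /andP[nvB ->]; rewrite andbT; apply: contra nvB.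
by move=> /imsetP[a aA ->]; rewrite (mem_imset _ _ val_inj) sub.
Qed.

Lemma coatom_above u : r u w -> u != w -> exists2 v, v \in P & r u v.
Proof.
move=> uw nuw; pose C z := [&& r u z, r z w & z != w].
have Cu : C u by rewrite /C rr uw.
case: (arg_maxnP (fun z => #|[set t | r t z]|) Cu) => v /and3P[uv vw nvw] maxv.
exists v => //; apply/coversP; split=> // z vz zw.
have [->|nzw] := eqVneq z w; [by right | left].
have sub : [set t | r t v] \subset [set t | r t z].
  by apply/subsetP=> t; rewrite !inE => /rt; apply.
have Cz : C z by rewrite /C (rt uv vz) zw nzw.
have /eqP eqvz : [set t | r t v] == [set t | r t z] by rewrite eqEcard sub; apply: maxv.
apply: req => //; suff: z \in [set t | r t v] by rewrite inE.
by rewrite eqvz inE.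
Qed.

Let big_meet_w A : r (big_meet A) w.
Proof. by have := rr (big_meet A); rewrite {1}le_big_meet => /andP[]. Qed.

(** An element [u] of the interval is its own join with [big_meet P], and [join_big_meet] exhibits
    this join as the meet of the coatoms above [u]. *)
Lemma meet_span_interval : meet_span r w P = order_interval r (big_meet P) w.
Proof.
rewrite meet_span_coatoms; apply/setP=> u; apply/imsetP/idP=> [[A + ->]|].
  by rewrite !inE big_meet_w andbT => sAP; rewrite le_big_meets.
rewrite inE => /andP[Pu uw]; exists [set x in P | r u x].
  by rewrite inE; apply/subsetP=> x; rewrite inE => /andP[].
rewrite -join_big_meet //; apply: req; first exact: join_l uw (big_meet_w P).
by rewrite (le_join _ uw (big_meet_w P)) rr.
Qed.

Lemma sum_sign_subsets (C : {set T}) :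
  (\sum_(A in powerset C) (-1) ^+ #|A| = (C == set0)%:R :> int)%R.
Proof.
(* Expand the product over [i] of [1 - (i \in C)]: the term indexed by [A] is [(-1) ^+ #|A|] if [A]
   lies in [C], and 0 otherwise. *)
have := @bigA_distr int 0%R 1%R *%R +%R T (fun i => - (i \in C)%:R)%R (fun=> 1%R).
have -> : (\prod_i (- (i \in C)%:R + 1) = (C == set0)%:R :> int)%R.
  have [->|/set0Pn[i iC]] := eqVneq C set0; last by rewrite (bigD1 i) //= iC mul0r.
  by rewrite big1 // => i _; rewrite inE oppr0 add0r.
move=> ->; rewrite [RHS]big_mkcond [LHS]big_mkcond /=; apply: eq_bigr => A _.
rewrite inE; case: (boolP (A \subset C)) => [/subsetP sAC|/subsetPn[i iA niC]].
  rewrite -big_mkcond -prodr_const; apply: eq_bigr => i iA.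
  by rewrite sAC.
by rewrite (bigD1 i) //= iA (negPf niC) oppr0 mul0r.
Qed.

Lemma moebius_sum u t : r u t ->
  (\sum_(z | r u z && r z t) moebius r u z = (u == t)%:R)%R.
Proof.
move=> ut; have [equt|nut] := eqVneq u t.
  rewrite (big_pred1 u) ?moebius_refl // => z; rewrite -equt.
  by apply/idP/eqP=> [/andP[uz zu]|->]; [exact: req | rewrite rr].
rewrite (bigD1 t) /=; last by rewrite ut rr.
rewrite (moebius_rec rP ut nut); apply/eqP; rewrite addrC subr_eq0; apply/eqP.
by apply: eq_bigl => z; rewrite andbA.
Qed.

Lemma moebius_coatoms u : r u w ->
  moebius r u w = if u \in meet_span r w P
                  then ((-1) ^+ #|[set v in P | r u v]|)%R else 0%R.
Proof.
(* g satisfies the recursion of the Moebius function in its first argument;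
   the double sum below turns it into the recursion in the second one. *)
pose g z : int := (if z \in meet_span r w P
                  then (-1) ^+ #|[set v in P | r z v]| else 0)%R.
(* The elements of the span above [z] are the meets of the subsets of [C], each obtained once, and
   [g] takes the sign of the subset. The sum vanishes unless [C] is empty, which by [coatom_above]
   forces [z = w]. *)
have sumg z : r z w -> (\sum_(t | r z t && r t w) g t = (z == w)%:R)%R.
  move=> zw; pose C := [set v in P | r z v].
  have sCP : C \subset P by apply/subsetP=> v; rewrite inE => /andP[].
  rewrite -big_mkcondr /=.
  rewrite (eq_bigl [in [set big_meet A | A in powerset C]]) => [|t]; last first.
    rewrite meet_span_coatoms; apply/andP/imsetP => [[/andP[zt tw] /imsetP[A + defA]]|].
      rewrite inE => /subsetP sAP; exists A; rewrite // inE; apply/subsetP=> v vA.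
      rewrite inE sAP //=; move: zt; rewrite defA le_big_meet => /andP[_ /forall_inP].
      by apply.
    case=> A; rewrite inE => sAC ->; split; last first.
      by rewrite imset_f // inE (subset_trans sAC).
    rewrite big_meet_w andbT le_big_meet zw /=; apply/forall_inP=> v /(subsetP sAC).
    by rewrite inE => /andP[].
  rewrite big_imset /= => [|A B]; last first.
    rewrite !inE => sAC sBC eqAB; apply/eqP; rewrite eqEsubset.
    have sP (D : {set T}) : D \subset C -> D \subset P.
      by move=> sDC; apply: subset_trans sDC sCP.
    rewrite -(le_big_meets (sP _ sBC) (sP _ sAC)).
    by rewrite -(le_big_meets (sP _ sAC) (sP _ sBC)) eqAB rr.
  rewrite (eq_bigr (fun A : {set T} => (-1) ^+ #|A|)%R) => [|A].
    rewrite sum_sign_subsets; congr (_%:R)%R; congr nat_of_bool.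
    apply/eqP/eqP=> [C0|eqzw].
      apply/eqP; apply: contraT => nzw; have [v vP zv] := coatom_above zw nzw.
      by have := in_set0 v; rewrite -C0 in_set vP zv.
    apply/setP=> v; rewrite /C eqzw !in_set; apply/negP=> /andP[/and3P[vw nvw _] wv].
    by rewrite (req vw wv) eqxx in nvw.
  rewrite inE => sAC; congr (_ ^+ _)%R; apply: eq_card => v; rewrite inE.
  have sAP := subset_trans sAC sCP.
  have [vP|nvP] := boolP (v \in P); first by rewrite big_meet_le_coatom.
  by apply/esym/negbTE; apply: contra nvP; apply/subsetP.
move=> uw; rewrite -/(g u).
(* [moebius] is a left inverse of the zeta function, and [g] is the column [w] of a right inverse;
   evaluating the double sum in both orders identifies them. *)
transitivity (\sum_(z | r u z && r z w) moebius r u z *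
                \sum_(t | r z t && r t w) g t)%R.
  rewrite (bigD1 w) /= ?uw ?rr // sumg // eqxx mulr1 big1 ?addr0 // => z.
  by case/andP=> /andP[uz zw] nzw; rewrite sumg // (negPf nzw) mulr0.
transitivity (\sum_(t | r u t && r t w) \sum_(z | r u z && r z t) moebius r u z * g t)%R.
  under eq_bigr do rewrite mulr_sumr.
  rewrite (exchange_big_dep (fun t => r u t && r t w)) /= => [|z t /andP[uz _] /andP[zt ->]].
    apply: eq_bigr => t /andP[ut tw]; apply: eq_bigl => z; rewrite tw andbT.
    by case uz: (r u z); rewrite //=; case zt: (r z t); rewrite ?andbF // (rt zt tw).
  by rewrite (rt uz zt).
rewrite (bigD1 u) /= ?uw ?rr // -mulr_suml moebius_sum ?rr // eqxx mul1r.
rewrite big1 ?addr0 // => t /andP[/andP[ut tw] ntu].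
by rewrite -mulr_suml moebius_sum // eq_sym (negPf ntu) mul0r.
Qed.

End Coatoms.

Lemma locally_distributive_meet_semilattice : meet_semilattice r.
Proof. by split=> // x y; exists (meet x y). Qed.

Lemma locally_distributive_meet_distributive : meet_distributive r.
Proof.
move=> x y; rewrite (capped_inf_coatoms _ (subxx _)) => /eqP->.
by rewrite -meet_span_interval; apply: boolean_meet_span_coatoms.
Qed.

(** * A second order sharing the bounded meets and joins *)

Section CompatibleOrder.

Variable q : rel T.

Definition bounded_lattice_operations : Prop :=
  partial_order q /\ forall x y w, r x w -> r y w ->
    is_inf q [set x; y] (meet x y) /\ is_sup q [set x; y] (join x y).

Hypothesis qP : bounded_lattice_operations.

(** Below a common bound, either order is recovered from the shared operation by the condition
    [meet x y = x]. *)
Lemma compatible_order_le x y w : r x w -> r y w -> r x y = q x y.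
Proof.
move=> xw yw; case: qP => qo /(_ x y w xw yw)[/[dup] infm /is_inf2P[mx my glb] _].
have [qr _ _] := qo; apply/idP/idP=> [xy|xy].
  by rewrite -(_ : meet x y = x) //; apply: req; rewrite ?meet_l // le_meet rr.
rewrite (is_inf_unique qo (m := x) (n := meet x y) _ infm) ?meet_r //.
by apply/is_inf2P; split=> [||z]; rewrite ?qr.
Qed.

Lemma compatible_order_sublattice u w :
  sublattice r q (order_interval r u w).
Proof.
split=> [x y|x y xI yI].
  by rewrite !inE => /andP[_ xw] /andP[_ yw]; apply: compatible_order_le xw yw.
have [[m mI minf] [j jI jsup]] := meet_join_closed_interval xI yI.
move: xI yI; rewrite !inE => /andP[_ xw] /andP[_ yw].
have [_ /(_ x y w xw yw)[infm supj]] := qP.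
rewrite -(is_inf_unique rP minf (meet_inf x y)) in infm.
rewrite -(is_sup2_unique rP jsup (join_sup xw yw)) in supj.
by split; [exists m | exists j].
Qed.

Lemma compatible_order_meet_span w :
  meet_span r w (lower_covers r w) = meet_span q w (lower_covers r w).
Proof.
apply/setP=> m; rewrite !inE; apply/eq_existsb => A.
apply: andb_id2l => sAP; rewrite (capped_inf_coatoms _ sAP).
have leA : {in A, forall x, r x w} by move=> x /(subsetP sAP)/coversP[].
have [qo qops] := qP; have [qr _ qt] := qo.
have leq_w x : r x w -> q x w by move=> xw; rewrite -(compatible_order_le xw (rr w)).
have qinf : is_inf q (w |: A) (big_meet w A).
  (* Partial meets stay below [w] for [r]; this invariant is what allows [qops] to be applied at
     each step. *)
  have in_seq (e : seq T) : r (\big[meet/w]_(x <- e | x \in A) x) w /\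
      forall z, q z (\big[meet/w]_(x <- e | x \in A) x)
                = q z w && all (fun x => (x \in A) ==> q z x) e.
    elim: e => [|x e [le_w IHe]].
      by rewrite big_nil; split=> // z; rewrite andbT.
    rewrite big_cons /=; case: ifP => // xA; have xw := leA x xA.
    split=> [|z]; first exact: rt (meet_l _ _) xw.
    have [/is_inf2P[mx mm glb] _] := qops _ _ _ xw le_w.
    rewrite -[q z w && _]andbCA /= -IHe; apply/idP/andP=> [zm|[zx zm]]; last exact: glb.
    by rewrite (qt _ _ _ zm mx) (qt _ _ _ zm mm).
  have [le_w qE] := in_seq (index_enum T); apply/is_infP; split=> [x|z lbz].
    have := qr (big_meet w A); rewrite {2}/big_meet qE => /andP[mw /allP mA].
    by case/setU1P=> [->|xA] //; have := mA x (mem_index_enum x); rewrite xA.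
  rewrite /big_meet qE lbz ?setU11 //=; apply/allP=> x _; apply/implyP=> xA.
  by rewrite lbz ?setU1r.
rewrite is_capped_infE // => [|x /leA/leq_w //].
by apply/eqP/idP=> [->//|infm]; apply: is_inf_unique infm qinf.
Qed.

End CompatibleOrder.

End LocallyDistributive.

(** * Length, inversions and parabolic subgroups *)

Section CoxeterSystem.

Local Open Scope group_scope.

Variables (gT : finGroupType) (I : finType) (s : I -> gT).
Hypothesis hW : coxeter_system s.
Implicit Types (i j k : I) (J K : {set I}) (t u v w x y z : gT) (e : seq I).

Local Notation "''l' w" := (coxeter_length s w)
  (at level 8, w at level 8, format "''l'  w").

Let s_inj : injective s. Proof. by case: hW. Qed.
Let s_gen : <<[set s i | i : I]>> = [set: gT]. Proof. by case: hW. Qed.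

Lemma simpleK i : s i * s i = 1.
Proof.
by case: hW => _ /(_ i) si2 _ _; rewrite -[RHS](expg_order (s i)) si2 expgS.
Qed.

Lemma simpleV i : (s i)^-1 = s i.
Proof. by apply/eqP; rewrite eq_invg_mul simpleK. Qed.

Definition word e : gT := \prod_(i <- e) s i.

Lemma word_cons i e : word (i :: e) = s i * word e.
Proof. exact: big_cons. Qed.

Lemma length_word_le e : 'l (word e) <= size e.
Proof.
by apply: coxeter_length_min; apply/existsP; exists (in_tuple e); apply/eqP.
Qed.

Lemma reduced_word w : exists2 e, w = word e & size e = 'l w.
Proof.
have /existsP[e /eqP def_w] := coxeter_length_has_word w s_gen.
by exists e; rewrite ?size_tuple // -def_w.

Qed.

Lemma coxeter_ind (Q : gT -> Prop) :
  Q 1 -> (forall i x, Q x -> Q (s i * x)) -> forall w, Q w.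
Proof.
move=> Q1 QM w; have [e -> _] := reduced_word w.
elim: e => [|i e IHe]; first by rewrite /word big_nil.
by rewrite word_cons; apply: QM.
Qed.

Lemma length1 : 'l 1 = 0%N.
Proof.
by apply/eqP; rewrite -leqn0; have := length_word_le [::]; rewrite /word big_nil.
Qed.

Lemma length_eq0 w : ('l w == 0%N) = (w == 1).
Proof.
apply/eqP/eqP=> [|->]; last exact: length1.
by have [e -> <-] := reduced_word w; move/size0nil->; rewrite /word big_nil.
Qed.

Lemma length_mul_le u v : 'l (u * v) <= 'l u + 'l v.
Proof.
have [d -> <-] := reduced_word u; have [e -> <-] := reduced_word v.
by rewrite -size_cat /word -big_cat length_word_le.
Qed.

Lemma length_inv w : 'l (w^-1) = 'l w.
Proof.
have le_inv x : 'l (x^-1) <= 'l x.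
  have [e -> <-] := reduced_word x; rewrite -size_rev.
  suff -> : (word e)^-1 = word (rev e) by apply: length_word_le.
  elim: e => [|i e IHe]; first by rewrite /word !big_nil invg1.
  by rewrite word_cons invMg IHe simpleV rev_cons /word big_rcons.
by apply/eqP; rewrite eqn_leq le_inv -{1}[w]invgK le_inv.
Qed.

Lemma length_simple_le i : 'l (s i) <= 1.
Proof. by have := length_word_le [:: i]; rewrite /word big_seq1. Qed.

(* The action of the Coxeter group on signed reflections (t, b): the generator
   s i conjugates t, and changes the sign exactly when t is s i itself. *)
Lemma inversion_cocycle : exists eta : gT -> gT -> bool,
  (forall i t, eta (s i) t = (t == s i)) /\
  (forall x y t, eta (x * y) t = eta x t (+) eta y (t ^ x)).
Proof.
pose a i (p : gT * bool) := (p.1 ^ s i, p.2 (+) (p.1 == s i)).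
have aK i : involutive (a i).
  move=> [t b]; rewrite /a /= -conjgM simpleK conjg1.
  by rewrite -(inj_eq (conjg_inj (s i))) [s i ^ s i]conjgE mulKg addbK.
pose A i := perm (inv_inj (aK i)).
have AE i p : A i p = a i p by rewrite permE.
have Arel i j : (A i * A j) ^+ #[s i * s j] = 1.
  set c := s i * s j; set m := #[c].
  have sic n : s i * c ^- n = c ^+ n * s i.
    have csi : c ^ s i = c^-1.
      by rewrite conjgE /c invMg !simpleV mulgA mulgA simpleK mul1g.
    by rewrite -expVgn -csi -conjXg conjgE simpleV !mulgA simpleK mul1g.
  have conj_eq n t x : (t ^ (c ^+ n) == x * s i) = (t * s i == c ^+ n * x * c ^+ n).
    have -> : c ^+ n * x * c ^+ n = (x * s i) ^ (c ^- n) * s i.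
      by rewrite conjgE invgK -!mulgA [s i * (_ * _)]mulgA sic -mulgA simpleK mulg1.
    by rewrite (inj_eq (mulIg _)) -(inj_eq (conjg_inj (c ^+ n))) conjgKV.
  (* Counting from 0, the [k]-th of the [2n] generators applied changes the sign of [t] exactly when
     [t * s i = c ^+ k]. For [n = m] the exponents run twice over a period of [c], so the changes
     cancel. *)
  have step n t b : ((A i * A j) ^+ n) (t, b) =
      (t ^ (c ^+ n), b (+) \big[addb/false]_(0 <= k < n.*2) (t * s i == c ^+ k)).
    elim: n => [|n IHn]; first by rewrite expg0 perm1 conjg1 big_geq ?addbF.
    rewrite expgSr !permM IHn !AE /a /= -!conjgM -expgSr.
    rewrite doubleS !big_nat_recr //= -!addbA; congr (_, _ (+) (_ (+) (_ (+) _))).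
      by rewrite -[s i in LHS]mul1g conj_eq mulg1 -expgD addnn.
    rewrite conjgM -(inj_eq (conjg_inj (s i))) -conjgM simpleK conjg1.
    by rewrite [s j ^ _]conjgE simpleV mulgA conj_eq -expgSr -expgD addSn addnn.
  apply/permP=> -[t b]; rewrite step perm1 expg_order conjg1 -addnn.
  rewrite (big_cat_nat (n := m)) ?leq_addr //=.
  have -> : \big[addb/false]_(m <= k < m + m) (t * s i == c ^+ k)
      = \big[addb/false]_(0 <= k < m) (t * s i == c ^+ k).
    rewrite -{1}[m]add0n big_addn addnK; apply: eq_bigr => k _.
    by rewrite expgD expg_order mulg1.
  by rewrite addbb addbF.
have [_ _ _ /(_ _ A Arel)[f fM fs]] := hW.
pose eta w t := (f w (t, false)).2.
have f1 : f 1 = 1 by apply: (mulgI (f 1)); rewrite -fM !mulg1.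
have fE w t b : f w (t, b) = (t ^ w, b (+) eta w t).
  rewrite /eta; elim/coxeter_ind: w t b => [|i x IHx] t b.
    by rewrite f1 !perm1 conjg1 addbF.
  by rewrite fM fs !permM !AE /a /= IHx [in RHS]IHx /= conjgM addbA.
exists eta; split=> [i t|x y t]; first by rewrite /eta fs AE.
by rewrite /eta fM permM (fE x) fE.
Qed.

(** * Reflections, inversions and the exchange condition *)

Definition reflections : {set gT} := class_support [set s i | i : I] [set: gT].

Definition inversions w : {set gT} := [set t in reflections | 'l (t * w) < 'l w].

Lemma simple_reflection i : s i \in reflections.
Proof. by rewrite -[s i]conjg1 memJ_class_support ?inE ?imset_f. Qed.

Lemma reflectionK t : t \in reflections -> t * t = 1.
Proof.
by case/imset2P=> _ x /imsetP[i _ ->] _ ->; rewrite -conjMg simpleK conj1g.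
Qed.

Lemma reflectionJ t x : (t ^ x \in reflections) = (t \in reflections).
Proof.
have sub z y : z \in reflections -> z ^ y \in reflections.
  case/imset2P=> r y' rS _ ->; rewrite -conjgM.
  by apply: memJ_class_support; rewrite ?inE.
by apply/idP/idP => /sub; [move/(_ x^-1); rewrite conjgK | apply].
Qed.

(** In any word, reduced or not, left multiplication by [t] deletes the first letter at which the
    sign of [t] changes. *)
Let exchange_cocycle (eta : gT -> gT -> bool) e t :
    (forall i t, eta (s i) t = (t == s i)) ->
    (forall x y t, eta (x * y) t = eta x t (+) eta y (t ^ x)) ->
  eta (word e) t -> t \in reflections /\
  exists e', [/\ t * word e = word e', size e' < size e & {subset e' <= e}].
Proof.
move=> eta_s eta_M; elim: e t => [|i e IHe] t.
  have := eta_M 1 1 t; rewrite mulg1 conjg1 addbb.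
  by rewrite /word big_nil => ->.
rewrite word_cons eta_M eta_s; case: eqP => /= [-> _|_ /IHe[]].
  split; first exact: simple_reflection.
  exists e; split=> //= [|j]; last by rewrite inE orbC => ->.
  by rewrite mulgA simpleK mul1g.
rewrite reflectionJ => tR [e' [eqe' lte sube]]; split=> //.
exists (i :: e'); split=> // [|j]; last first.
  by rewrite !inE => /predU1P[->|/sube->]; rewrite ?eqxx ?orbT.
by rewrite word_cons -eqe' conjgE simpleV !mulgA simpleK mul1g.
Qed.

(** By exchange, [eta w t] implies a drop in length. Conversely [eta t t] holds, so if [eta w t]
    fails then [eta (t * w) t] holds, and it is the passage from [t * w] to [w] that shortens. *)
Let inversions_cocycle : exists2 eta : gT -> gT -> bool,
  (forall w t, (t \in inversions w) = eta w t) &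
  (forall i t, eta (s i) t = (t == s i)) /\
  (forall x y t, eta (x * y) t = eta x t (+) eta y (t ^ x)).
Proof.
have [eta [eta_s eta_M]] := inversion_cocycle; exists eta => // w t.
have eta1 x : eta 1 x = false.
  by have := eta_M 1 1 x; rewrite mulg1 conjg1 addbb.
have eta_inv x z : eta x z -> z \in inversions x.
  have [e -> sz] := reduced_word x.
  move=> /(exchange_cocycle eta_s eta_M)[zR [e' [eqe' lte _]]].
  by rewrite inE zR eqe' (leq_ltn_trans (length_word_le e')) // -sz.
apply/idP/idP=> [|/eta_inv//]; rewrite inE => /andP[tR ltw].
apply: contraLR ltw => net; rewrite -leqNgt ltnW //.
(* For [t = s i ^ x], the contributions of [x^-1] and [x] to the cocycle cancel, leaving that of
   [s i] at itself. *)
have eta_tt : eta t t.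
  case/imset2P: (tR) => _ x /imsetP[i _ ->] _ ->.
  have eqx : eta x^-1 (s i ^ x) = eta x (s i).
    by have := eta_M x x^-1 (s i); rewrite mulgV eta1; case: (eta x _); case: (eta _ _).
  rewrite [X in eta X]conjgE eta_M eqx eta_M -conjgM mulgV conjg1 eta_s eqxx.
  by rewrite conjgE mulKg addbC addTb addNb addbb.
have : eta (t * w) t by rewrite eta_M eta_tt conjgE mulKg (negPf net).
by move/eta_inv; rewrite inE mulgA reflectionK // mul1g => /andP[].
Qed.

Lemma inversions_simple i : inversions (s i) = [set s i].
Proof.
have [eta etaE [eta_s _]] := inversions_cocycle.
by apply/setP=> t; rewrite etaE eta_s inE.
Qed.

Lemma inversionsM x y t :
  (t \in inversions (x * y)) = (t \in inversions x) (+) (t ^ x \in inversions y).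
Proof. by have [eta etaE [_ eta_M]] := inversions_cocycle; rewrite !etaE eta_M. Qed.

Lemma inversions1 : inversions 1 = set0.
Proof.
by apply/setP=> t; have := inversionsM 1 1 t; rewrite mulg1 conjg1 addbb in_set0.
Qed.

Lemma exchange e t : t \in inversions (word e) ->
  exists e', [/\ t * word e = word e', size e' < size e & {subset e' <= e}].
Proof.
have [eta etaE [eta_s eta_M]] := inversions_cocycle; rewrite etaE.
by case/(exchange_cocycle eta_s eta_M).
Qed.

Lemma inversion_lt w t : t \in inversions w -> 'l (t * w) < 'l w.
Proof. by rewrite inE => /andP[]. Qed.

Lemma simple_inversionE i w : (s i \in inversions w) = ('l (s i * w) < 'l w).
Proof. by rewrite inE simple_reflection. Qed.

Lemma simple_inversion_mul i w :
  (s i \in inversions (s i * w)) = (s i \notin inversions w).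
Proof. by rewrite inversionsM inversions_simple set11 conjgE mulKg. Qed.

Lemma length_simple_mul i w :
  'l (s i * w) = if s i \in inversions w then ('l w).-1 else ('l w).+1.
Proof.
have le1 x : 'l (s i * x) <= ('l x).+1.
  by rewrite (leq_trans (length_mul_le _ _)) // -add1n leq_add2r length_simple_le.
have := simple_inversion_mul i w; rewrite !simple_inversionE mulgA simpleK mul1g.
have := le1 w; have := le1 (s i * w); rewrite mulgA simpleK mul1g.
move: ('l w) ('l (s i * w)) => n m; case: (ltnP m n) => [ltm|_] lenm lemn ltnm; apply/eqP.
  by rewrite eqn_leq -ltnS (ltn_predK ltm) ltm -subn1 leq_subLR add1n lenm.
by rewrite eqn_leq lemn ltnm.
Qed.

Lemma descent_exists w : w != 1 -> exists i, s i \in inversions w.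
Proof.
have [[|i e] -> sz] := reduced_word w; first by rewrite /word big_nil eqxx.
move=> _; exists i; rewrite simple_inversionE -sz word_cons mulgA simpleK mul1g ltnS.
exact: length_word_le.
Qed.

(** If [t] is an inversion of [u] but not of [w], the cocycle makes both factors of
    [(t * u) * (u^-1 * t * w) = w] too short for ['l w]. Conversely, a left descent of [u] is one of
    [w], and stripping it from both keeps the inclusion. *)
Lemma weakR_inversions u w : weakR s u w = (inversions u \subset inversions w).
Proof.
apply/eqP/idP => [lw|].
  apply/subsetP=> t tu; rewrite -[w](mulKVg u) inversionsM tu /=.
  apply/negP=> tuw; have := inversion_lt tu; have := inversion_lt tuw.
  have -> : t ^ u * (u^-1 * w) = u^-1 * (t * w) by rewrite conjgE !mulgA mulgK.
  move=> lt1 lt2; have := length_mul_le (t * u) (u^-1 * (t * w)).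
  have -> : t * u * (u^-1 * (t * w)) = w.
    by rewrite -!mulgA mulKVg mulgA reflectionK ?mul1g //; case/setIdP: tu.
  by rewrite leqNgt lw -addSn leq_add // ltnW.
have [n] := ubnP ('l u); elim: n u w => // n IHn u w ltn sub_uw.
have [->|nu1] := eqVneq u 1; first by rewrite length1 invg1 mul1g.
have [i ui] := descent_exists nu1; have wi := subsetP sub_uw _ ui.
have lu : 'l u = ('l (s i * u)).+1.
  by rewrite length_simple_mul ui prednK // (leq_trans _ (inversion_lt ui)).
have lw : 'l w = ('l (s i * w)).+1.
  by rewrite length_simple_mul wi prednK // (leq_trans _ (inversion_lt wi)).
have -> : u^-1 * w = (s i * u)^-1 * (s i * w).
  by rewrite invMg simpleV -mulgA [s i * (_ * _)]mulgA simpleK mul1g.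
rewrite lu lw addSn; congr _.+1; apply: IHn; first by rewrite -ltnS -lu.
apply/subsetP=> t; rewrite !inversionsM !inversions_simple !in_set1.
have [->|_] /= := eqVneq t (s i); last by exact: (subsetP sub_uw).
by rewrite conjgE mulKg ui.
Qed.

(** * Parabolic subgroups and minimal coset representatives *)

Local Notation W := (parabolic s).

Lemma parabolic_group J : group_set (W J).
Proof. exact: groupP. Qed.
Canonical parabolic_as_group J := Group (parabolic_group J).

Lemma simple_parabolic J j : j \in J -> s j \in W J.
Proof. by move=> jJ; rewrite mem_gen // imset_f. Qed.

Lemma parabolic_sub J K : J \subset K -> W J \subset W K.
Proof. by move=> sJK; rewrite genS // imsetS. Qed.

(** Exchange only deletes letters, so an element of [W J] will have a reduced word with letters in
    [J]. *)
Lemma reduced_subword e :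
  exists e', [/\ word e' = word e, size e' = 'l (word e) & {subset e' <= e}].
Proof.
elim: e => [|i e [e' [def_e sz_e sub_e]]].
  by exists [::]; rewrite /word big_nil length1.
rewrite word_cons length_simple_mul; case: ifP => [inv_i|_]; last first.
  exists (i :: e'); rewrite word_cons def_e /= sz_e; split=> // j.
  by rewrite !inE => /predU1P[->|/sub_e->]; rewrite ?eqxx ?orbT.
rewrite -def_e in inv_i *; have [d [def_d ltd sub_d]] := exchange inv_i.
exists d; split=> // [|j /sub_d/sub_e je]; last by rewrite inE je orbT.
apply/eqP; rewrite eqn_leq !def_e -sz_e; apply/andP; split.
  by rewrite -ltnS (ltn_predK ltd).
have := length_word_le d.
by rewrite -def_d length_simple_mul inv_i def_e sz_e.
Qed.

Lemma parabolic_reduced_word J x : x \in W J ->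
  exists e, [/\ x = word e, size e = 'l x & {subset e <= J}].
Proof.
case/gen_prodgP=> n [c cJ ->].
have [e -> subJ] : exists2 e, \prod_(i < n) c i = word e & {subset e <= J}.
  elim: n c cJ => [|n IHn] c cJ; first by exists [::]; rewrite ?big_ord0 /word ?big_nil.
  have [e def_e subJ] := IHn (c \o lift ord0) (fun k : 'I_n => cJ (lift ord0 k)).
  have /imsetP[j jJ def_c] := cJ ord0.
  exists (j :: e) => [|i /predU1P[->//|/subJ//]].
  by rewrite big_ord_recl word_cons -def_e def_c.
have [e' [def_e sz_e sub_e]] := reduced_subword e.
by exists e'; split=> // j /sub_e/subJ.
Qed.

Lemma parabolic_inversions J x : x \in W J -> inversions x \subset W J.
Proof.
case/parabolic_reduced_word=> e [-> _]; elim: e => [|i e IHe] subJ.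
  by rewrite /word big_nil inversions1 sub0set.
have iJ : s i \in W J by rewrite simple_parabolic // subJ ?mem_head.
apply/subsetP=> t; rewrite word_cons inversionsM inversions_simple inE.
have [->//|_ /= te] := eqVneq t (s i).
rewrite -(memJ_norm _ (subsetP (normG _) _ iJ)).
by apply: subsetP te; apply: IHe => j je; rewrite subJ // inE je orbT.
Qed.

Lemma simple_parabolicE J i : (s i \in W J) = (i \in J).
Proof.
apply/idP/idP=> [/parabolic_reduced_word[e [def_e sz_e subJ]]|]; last first.
  exact: simple_parabolic.
have := inversions_simple i; case: e def_e sz_e subJ => [|j [|k e]] def_e sz_e subJ.
- by rewrite def_e /word big_nil inversions1 => /setP/(_ 1); rewrite !inE eqxx.
- by move: def_e; rewrite /word big_seq1 => /s_inj->; rewrite subJ ?mem_head.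
by have := length_simple_le i; rewrite -sz_e.
Qed.

Lemma parabolic_descent J x i : x \in W J -> s i \in inversions x -> i \in J.
Proof. by move/parabolic_inversions/subsetP=> sub /sub; rewrite simple_parabolicE. Qed.

(** By induction on length: a left descent of an element of both subgroups has its index in [J] and
    in [K], and can be stripped off. *)
Lemma parabolicI J K : W (J :&: K) = W J :&: W K.
Proof.
apply/eqP; rewrite eqEsubset subsetI !parabolic_sub ?subsetIl ?subsetIr //=.
apply/subsetP=> x; have [n] := ubnP ('l x); elim: n x => // n IHn x ltx.
have [->|/descent_exists[i xi]] := eqVneq x 1; first by rewrite group1.
case/setIP=> xJ xK.
have iJ := parabolic_descent xJ xi; have iK := parabolic_descent xK xi.
rewrite -(groupMl _ (simple_parabolic _ : s i \in W (J :&: K))) ?inE ?iJ ?iK //.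
apply: IHn; first exact: leq_trans (inversion_lt xi) _.
by rewrite inE !groupM ?simple_parabolic.
Qed.

Lemma parabolicU J K : W (J :|: K) = W J <*> W K.
Proof. by rewrite /parabolic imsetU joing_idl joing_idr. Qed.

(** Local minimality implies global minimality: lengths add for the shortest element [v0] of
    [W J :* v], and if [v0 = y * v] with [y] nontrivial, then [v] would have a left descent in
    [J]. *)
Lemma left_min_length J v x : (forall j, j \in J -> s j \notin inversions v) ->
  x \in W J -> 'l (x * v) = ('l x + 'l v)%N.
Proof.
move=> minv xJ.
have vv : v \in W J :* v by rewrite rcoset_refl.
case: (arg_minnP (fun z => 'l z) vv) => v0 /rcosetP[y yJ def_v0] min0.
have min_mul z : z \in W J -> 'l (z * v0) = ('l z + 'l v0)%N.
  have [n] := ubnP ('l z); elim: n z => // n IHn z ltz zJ.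
  have [->|/descent_exists[i zi]] := eqVneq z 1; first by rewrite mul1g length1.
  have siJ : s i \in W J by rewrite simple_parabolic // (parabolic_descent zJ zi).
  pose z' := s i * z; have def_z : z = s i * z' by rewrite mulgA simpleK mul1g.
  have z'J : z' \in W J by rewrite groupM.
  have z'i : s i \notin inversions z' by rewrite -simple_inversion_mul -def_z.
  have ltz' : 'l z' < n by apply: leq_trans (inversion_lt zi) _.
  clearbody z'; rewrite def_z -mulgA !length_simple_mul (negPf z'i) inversionsM.
  rewrite (negPf z'i) IHn //=.
  (* Otherwise the reflection [s i ^ z'] of [W J] would shorten [v0]. *)
  rewrite ifN //; apply/negP=> /inversion_lt; rewrite ltnNge min0 // def_v0 mulgA.
  change (s i ^ z' * y * v \in W J :* v).
  by rewrite mem_rcoset mulgK groupM // groupJ.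
suff y1 : y = 1 by rewrite -[v]mul1g -y1 -def_v0 min_mul.
apply/eqP; rewrite -[y == 1]eq_invg1; apply: contraT => /descent_exists[i yi].
have yVJ : y^-1 \in W J by rewrite groupV.
have iJ := parabolic_descent yVJ yi.
have := minv i iJ; rewrite simple_inversionE -[v](mulKg y) -def_v0 mulgA.
by rewrite !min_mul ?groupM ?simple_parabolic // ltn_add2r (inversion_lt yi).
Qed.

Lemma left_min_inversions J v t : (forall j, j \in J -> s j \notin inversions v) ->
  t \in W J -> t \notin inversions v.
Proof.
move=> minv tJ; apply/negP=> /inversion_lt.
by rewrite (left_min_length minv tJ) ltnNge leq_addl.
Qed.

Lemma right_min_length K v x : no_right_descent s K v -> x \in W K ->
  'l (v * x) = ('l v + 'l x)%N.
Proof.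
move=> /forall_inP minv xK; rewrite -length_inv invMg.
rewrite (left_min_length (J := K)) ?groupV //; first by rewrite !length_inv addnC.
move=> k /minv/ltnW; rewrite simple_inversionE -leqNgt length_inv.
by rewrite -[s k in X in _ -> _ <= X]simpleV -invMg length_inv.
Qed.

Lemma simple_neq1 i : s i != 1.
Proof.
apply/eqP=> si1; have := inversions_simple i.
by rewrite si1 inversions1 => /setP/(_ 1); rewrite !inE eqxx.
Qed.

Lemma parabolic_simple J x : x \in W J -> x != 1 -> 'l x <= 1 ->
  exists2 j, j \in J & x = s j.
Proof.
case/parabolic_reduced_word=> -[|j [|k e]] [-> <- subJ] //.
  by rewrite /word big_nil eqxx.
by exists j; rewrite ?subJ ?mem_head // /word big_seq1.
Qed.

Lemma weakR_order : partial_order (weakR s).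
Proof.
split=> [u|u v /andP[/eqP luv /eqP lvu]|v u w].
- by rewrite weakR_inversions.
- apply/eqP; rewrite eq_mulVg1 -length_eq0 eqn0Ngt; apply/negP=> lt0.
  have := leq_addr ('l (v^-1 * u)) ('l v).
  by rewrite -lvu luv -[X in _ <= X]addn0 leq_add2l leqNgt lt0.
by rewrite !weakR_inversions; apply: subset_trans.
Qed.

Lemma weakLV u w : weakL s u w = weakR s u^-1 w^-1.
Proof.
by rewrite /weakL /weakR !length_inv invgK -(length_inv (u * w^-1)) invMg invgK.
Qed.

Lemma weakL_order : partial_order (weakL s).
Proof.
have [rr ra rt] := weakR_order.
split=> [u|u v|v u w]; rewrite !weakLV //; first by move/ra/invg_inj.
exact: rt.
Qed.

(* The k such that v s_k is a cover of v in both weak orders. By [cuttingE]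
   below, the elements above v for cutting form the coset v W_K, where K is
   this set. *)
Definition short_nondescents v : {set I} :=
  [set k | ('l v < 'l (v * s k)) && [exists j, s k ^ v^-1 == s j]].

Local Notation N := short_nondescents.

Lemma short_right_min v : no_right_descent s (N v) v.
Proof. by apply/forall_inP=> k; rewrite inE => /andP[]. Qed.

(** Conjugation by [v^-1] maps the generators indexed by [N v] onto those indexed by [N v^-1]; thus
    [N v] is a right block of [v]. *)
Lemma parabolic_shortJ v : W (N v) :^ v^-1 = W (N v^-1).
Proof.
have sub u k : k \in N u -> exists2 j, j \in N u^-1 & s k ^ u^-1 = s j.
  rewrite inE => /andP[ltu /existsP[j /eqP def_j]]; exists j => //.
  rewrite inE; apply/andP; split; last first.
    by apply/existsP; exists k; rewrite -def_j invgK conjgKV.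
  have -> : u^-1 * s j = (u * s k)^-1 by rewrite -def_j conjgE invgK invMg simpleV mulKg.
  by rewrite !length_inv.
rewrite /parabolic -genJ; congr <<_>>; apply/setP=> x; rewrite mem_conjgV.
apply/imsetP/imsetP=> -[k kN def_x].
  by have [j jN def_j] := sub _ _ kN; exists j; rewrite // -def_j -def_x conjgK.
have [j + def_j] := sub _ _ kN; rewrite !invgK in def_j * => jN.
by exists j; rewrite // def_x.
Qed.

(** Compute the length of [v * x = (x ^ v^-1) * v] from both sides, [v] being minimal on the right
    for [N v] and on the left for [N v^-1]. *)
Lemma length_shortJ v x : x \in W (N v) -> 'l (x ^ v^-1) = 'l x.
Proof.
move=> xN; have x'N : x ^ v^-1 \in W (N v^-1) by rewrite -parabolic_shortJ memJ_conjg.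
have := right_min_length (short_right_min v^-1) (groupVr x'N).
rewrite !length_inv -invMg length_inv -conjgCV.
by rewrite (right_min_length (short_right_min v) xN) => /addnI/esym.
Qed.

(* If u x s_k = s_j u x > u x, then u s_k > u, so that u is right minimal for
   the parabolic subgroup containing the reflection t = x s_k x^-1. Since
   u t = s_j u, the length of t is 1, so t is simple. *)
Lemma short_nondescentsM u x : x \in W (N u) -> N (u * x) \subset N u.
Proof.
move=> xN; apply/subsetP=> k; rewrite inE => /andP[ltk /existsP[j /eqP def_j]].
have ltu : 'l u < 'l (u * s k).
  rewrite ltnNge; apply: contraL ltk => leu; rewrite -leqNgt.
  rewrite (right_min_length (short_right_min u) xN) -(length_shortJ xN) addnC.
  by rewrite [u * x]conjgCV -mulgA (leq_trans (length_mul_le _ _)) // leq_add2l.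
have min_u : no_right_descent s (k |: N u) u.
  by apply/forall_inP=> i /setU1P[->//|]; rewrite inE => /andP[].
set t := s k ^ x^-1.
have xkN : x \in W (k |: N u) by apply: subsetP xN; rewrite parabolic_sub ?subsetUr.
have tk : t \in W (k |: N u) by rewrite groupJ ?groupV // simple_parabolic ?setU11.
have ut : u * t = s j * u by rewrite conjgCV -def_j invMg conjgM.
have lt1 : 'l t <= 1.
  have := length_mul_le (s j) u; rewrite -ut (right_min_length min_u tk).
  by rewrite addnC leq_add2r => /leq_trans; apply; apply: length_simple_le.
have t1 : t != 1 by rewrite conjg_eq1 simple_neq1.
have [i /setU1P[->|iN] def_t] := parabolic_simple tk t1 lt1.
  by rewrite inE ltu; apply/existsP; exists j; rewrite -def_j invMg conjgM -/t def_t.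
rewrite -simple_parabolicE (_ : s k = t ^ x); last by rewrite conjgKV.
by rewrite groupJ // def_t simple_parabolic.
Qed.

(** * Right blocks and the cutting relation *)

(** Conjugacy of parabolic subgroups, unlike equality of cosets, is visibly compatible with joins
    and intersections. *)
Lemma right_blockE J K w : (W J :* w == w *: W K) = (W J == W K :^ w^-1).
Proof.
apply/eqP/eqP=> eqJK; apply/setP=> y.
  by rewrite mem_conjgV conjgE -mem_lcoset -eqJK mem_rcoset mulgK.
by rewrite mem_rcoset eqJK mem_conjgV conjgE mulgKV mem_lcoset.
Qed.

Section Blocks.

Variables (J K : {set I}) (w v : gT).
Hypothesis blockK : W J = W K :^ w^-1.
Hypothesis upv : is_upper_factor s K w v.

Lemma upper_factor_mem : v^-1 * w \in W K.
Proof. by case/andP: upv => /exists_inP[x xK /eqP->] _; rewrite mulKg. Qed.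

Lemma upper_factor_block : W J = W K :^ v^-1.
Proof.
rewrite blockK -{1}[w](mulKVg v) invMg conjsgM; congr (_ :^ _).
by rewrite conjGid // groupV upper_factor_mem.
Qed.

Let left_min j : j \in J -> s j \notin inversions v.
Proof.
case/andP: upv => _ minv jJ; have : s j \in W J by rewrite simple_parabolic.
rewrite upper_factor_block => /imsetP[z zK def_j].
by rewrite simple_inversionE def_j -conjgCV (right_min_length minv zK) -leqNgt leq_addr.
Qed.

(** Being left minimal for [J], [v] has no inversion in [W J]. An inversion distinguishing [w] from
    [v] comes from [v^-1 * w] in [W K], and conjugation by [v^-1] moves it into [W J]. *)
Lemma upper_factor_inversions : inversions v = inversions w :\: W J.
Proof.
apply/setP=> t; rewrite in_setD; have [tJ|ntJ] /= := boolP (t \in W J).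
  exact/negbTE/(left_min_inversions left_min).
rewrite -[w](mulKVg v) inversionsM [_ \in inversions (v^-1 * w)](_ : _ = false) ?addbF //.
apply: contraNF ntJ => /(subsetP (parabolic_inversions upper_factor_mem)).
by rewrite upper_factor_block mem_conjgV.
Qed.

(** For [k] in [K], write [v * s k = x * v] with [x = s k ^ v^-1] in [W J]. Left minimality makes
    lengths add, so [x] has length at most 1 and is simple. *)
Lemma upper_factor_short : K \subset N v.
Proof.
case/andP: upv => _ minv; apply/subsetP=> k kK; rewrite inE (forall_inP minv) //=.
have kJ : s k ^ v^-1 \in W J by rewrite upper_factor_block memJ_conjg simple_parabolic.
have [||j _ ->] := parabolic_simple kJ; first by rewrite conjg_eq1 simple_neq1.
  have := length_mul_le v (s k); rewrite conjgCV (left_min_length left_min kJ) addnC.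
  by rewrite leq_add2l => /leq_trans; apply; apply: length_simple_le.
by apply/existsP; exists j.
Qed.

End Blocks.

Lemma upper_factorE K w v :
  is_upper_factor s K w v = (v^-1 * w \in W K) && no_right_descent s K v.
Proof.
congr (_ && _); apply/exists_inP/idP=> [[x xK /eqP->]|wK]; first by rewrite mulKg.
by exists (v^-1 * w); rewrite ?mulKVg.
Qed.

Lemma upper_factor_exists K w : exists v, is_upper_factor s K w v.
Proof.
have ww : w \in w *: W K by rewrite lcoset_refl.
case: (arg_minnP (fun z => 'l z) ww) => v vw minv; exists v.
change (is_true (v \in w *: W K)) in vw; rewrite mem_lcoset in vw.
rewrite upper_factorE -groupV invMg invgK vw /=; apply/forall_inP=> k kK.
have siK := simple_parabolic kK.
rewrite ltn_neqAle [X in _ && X]minv ?andbT; last first.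
  by change (v * s k \in w *: W K); rewrite mem_lcoset mulgA groupM.
rewrite -length_inv -['l (v * _)]length_inv invMg simpleV length_simple_mul.
case: ifP => [/inversion_lt|_]; last by rewrite ltn_eqF.
by case: ('l v^-1) => // n _; rewrite gtn_eqF /=.
Qed.

Lemma same_coset K u v w : u^-1 * w \in W K -> v^-1 * w \in W K -> u^-1 * v \in W K.
Proof.
move=> uw vw; have -> : u^-1 * v = (u^-1 * w) * (v^-1 * w)^-1.
  by rewrite invMg invgK mulgA mulgK.
by rewrite groupM ?groupV.
Qed.

Lemma cuttingP v w :
  reflect (exists J K, W J = W K :^ w^-1 /\ is_upper_factor s K w v) (cutting s v w).
Proof.
apply: (iffP existsP) => [[K /andP[/existsP[J]]]|[J [K [blockK upv]]]].
  by rewrite right_blockE => /eqP; exists J, K.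
by exists K; rewrite upv andbT; apply/existsP; exists J; rewrite right_blockE blockK.
Qed.

(** [N v] is the largest block that can produce [v]: every [K] as in [cuttingP] lies in it, and it
    is itself a right block of [w] once [v^-1 * w] lies in its parabolic subgroup. *)
Lemma cuttingE v w : cutting s v w = (v^-1 * w \in W (N v)).
Proof.
apply/cuttingP/idP=> [[J [K [blockK upv]]]|wN].
  apply: subsetP (upper_factor_mem upv).
  by rewrite parabolic_sub ?(upper_factor_short blockK upv).
exists (N v^-1), (N v); rewrite upper_factorE wN short_right_min; split=> //.
rewrite -parabolic_shortJ -[w](mulKVg v) invMg conjsgM; congr (_ :^ _).
by rewrite conjGid ?groupV.
Qed.

Lemma cutting1 w : cutting s 1 w.
Proof.
rewrite cuttingE invg1 mul1g.
have -> : N 1 = setT.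
  apply/setP=> k; rewrite !inE mul1g length1 invg1 conjg1 lt0n length_eq0 simple_neq1.
  by apply/existsP; exists k.
rewrite /parabolic (_ : [set s j | j in setT] = [set s i | i : I]) ?s_gen ?inE //.
by apply/setP=> x; apply/imsetP/imsetP=> -[i _ ->]; exists i; rewrite ?inE.
Qed.

Lemma cutting_weakR v w : cutting s v w -> weakR s v w.
Proof.
rewrite cuttingE => wN; rewrite /weakR -{1}[w](mulKVg v).
by rewrite (right_min_length (short_right_min v) wN).
Qed.

(** This symmetry, which rests on [parabolic_shortJ], transfers results from right order to left
    order. *)
Lemma cuttingV v w : cutting s v^-1 w^-1 = cutting s v w.
Proof.
have sub u x : cutting s u x -> cutting s u^-1 x^-1.
  rewrite !cuttingE -parabolic_shortJ invgK mem_conjgV => ux.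
  by rewrite conjgE -mulgA mulKg -groupV invMg invgK.
by apply/idP/idP=> /sub //; rewrite !invgK.
Qed.

Lemma cutting_weakL v w : cutting s v w -> weakL s v w.
Proof. by rewrite weakLV -cuttingV; apply: cutting_weakR. Qed.

Lemma cutting_order : partial_order (cutting s).
Proof.
have [_ ra _] := weakR_order.
split=> [u|u v /andP[uv vu]|v u w]; first by rewrite cuttingE mulVg group1.
  by apply: ra; rewrite !cutting_weakR.
rewrite !cuttingE => uv vw; rewrite -(mulKVg v w) mulgA groupM //.
apply: subsetP vw; rewrite parabolic_sub // -[v](mulKVg u).
exact: short_nondescentsM.
Qed.

Lemma cutting_upper J J' K K' w u v : K \subset K' ->
    W J = W K :^ w^-1 -> W J' = W K' :^ w^-1 ->
    is_upper_factor s K w u -> is_upper_factor s K' w v ->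
  cutting s v u.
Proof.
move=> sKK' bK bK' upu upv; rewrite cuttingE.
apply: (subsetP (parabolic_sub (upper_factor_short bK' upv))).
apply: same_coset (upper_factor_mem upv) _.
exact: subsetP (parabolic_sub sKK') _ (upper_factor_mem upu).
Qed.

(** * Meets and joins of the elements cut out by two blocks *)

Section TwoBlocks.

Variables (J J' K K' : {set I}) (w u v : gT).
Hypothesis blockK : W J = W K :^ w^-1.
Hypothesis blockK' : W J' = W K' :^ w^-1.
Hypothesis upu : is_upper_factor s K w u.
Hypothesis upv : is_upper_factor s K' w v.

Lemma blockU : W (J :|: J') = W (K :|: K') :^ w^-1.
Proof. by rewrite !parabolicU conjYg -blockK -blockK'. Qed.

Lemma blockI : W (J :&: J') = W (K :&: K') :^ w^-1.
Proof. by rewrite !parabolicI conjIg -blockK -blockK'. Qed.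

(** A lower bound [z] of [u] and [v] has no inversion in [W J] or [W J'], in particular no [s j]
    with [j] in [J :|: J']; by [left_min_inversions] it then has none in [W (J :|: J')]. *)
Lemma weakR_inf_upper m : is_upper_factor s (K :|: K') w m ->
  is_inf (weakR s) [set u; v] m.
Proof.
move=> upm; have inv_m := upper_factor_inversions blockU upm.
have inv_u := upper_factor_inversions blockK upu.
have inv_v := upper_factor_inversions blockK' upv.
apply/is_inf2P; rewrite !weakR_inversions inv_m inv_u inv_v.
split; rewrite ?setDS ?parabolic_sub ?subsetUl ?subsetUr // => z.
rewrite !weakR_inversions inv_u inv_v inv_m !subsetD => /andP[zw dzJ] /andP[_ dzJ'].
rewrite zw /=; rewrite disjoint_subset; apply/subsetP=> t tz; rewrite inE.
apply: contraL tz; apply: left_min_inversions => j; apply: contraL => jz.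
rewrite inE negb_or -!simple_parabolicE.
by rewrite (disjointFr dzJ jz) (disjointFr dzJ' jz).
Qed.

(** Since [W (J :&: J')] is the intersection of [W J] and [W J'], the inversion set of [y] is the
    union of those of [u] and [v]. *)
Lemma weakR_sup_upper y : is_upper_factor s (K :&: K') w y ->
  is_sup (weakR s) [set u; v] y.
Proof.
move=> upy; have inv_y := upper_factor_inversions blockI upy.
rewrite parabolicI setDIr -(upper_factor_inversions blockK upu) in inv_y.
rewrite -(upper_factor_inversions blockK' upv) in inv_y.
apply/is_sup2P; rewrite !weakR_inversions inv_y subsetUl subsetUr; split=> // z.
by rewrite !weakR_inversions inv_y subUset => -> ->.
Qed.

(** If [z] is below [u] and [v], then [N z] contains [K] and [K'] because [N] is decreasing, so [w]
    and [m] both lie in the coset [z *: W (N z)]. *)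
Lemma cutting_inf_upper m : is_upper_factor s (K :|: K') w m ->
  is_inf (cutting s) [set u; v] m.
Proof.
move=> upm; apply/is_inf2P; split.
- exact: cutting_upper (subsetUl _ _) blockK blockU upu upm.
- exact: cutting_upper (subsetUr _ _) blockK' blockU upv upm.
move=> z zu zv; have sN x : cutting s z x -> N x \subset N z.
  by rewrite cuttingE -{2}[x](mulKVg z); apply: short_nondescentsM.
have sKz : K :|: K' \subset N z.
  rewrite subUset (subset_trans (upper_factor_short blockK upu) (sN _ zu)).
  by rewrite (subset_trans (upper_factor_short blockK' upv) (sN _ zv)).
have sWz := subsetP (parabolic_sub sKz).
rewrite cuttingE in zu; rewrite cuttingE.
apply: (same_coset (w := w)); last exact: sWz (upper_factor_mem upm).
rewrite -(mulKVg u w) mulgA groupM //; apply: sWz; apply: subsetP (upper_factor_mem upu).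
by rewrite parabolic_sub ?subsetUl.
Qed.

End TwoBlocks.

(** An upper bound [z] has its own blocks producing [u] and [v]; their intersection cuts from [z] a
    supremum in right order, which must be [y]. *)
Lemma cutting_sup_upper J J' K K' w u v y :
    W J = W K :^ w^-1 -> W J' = W K' :^ w^-1 ->
    is_upper_factor s K w u -> is_upper_factor s K' w v ->
    is_upper_factor s (K :&: K') w y ->
  is_sup (cutting s) [set u; v] y.
Proof.
move=> bK bK' upu upv upy; apply/is_sup2P; split.
- exact: cutting_upper (subsetIl _ _) (blockI bK bK') bK upy upu.
- exact: cutting_upper (subsetIr _ _) (blockI bK bK') bK' upy upv.
move=> z /cuttingP[J1 [K1 [bK1 upu1]]] /cuttingP[J2 [K2 [bK2 upv2]]].
have [y' upy'] := upper_factor_exists (K1 :&: K2) z.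
have supy := weakR_sup_upper bK bK' upu upv upy.
rewrite (is_sup2_unique weakR_order supy (weakR_sup_upper bK1 bK2 upu1 upv2 upy')).
by apply/cuttingP; exists (J1 :&: J2), (K1 :&: K2); rewrite (blockI bK1 bK2).
Qed.

(** The choice always succeeds for the meet; for the join it fails exactly on pairs without a common
    upper bound. *)
Definition cutting_meet x y := odflt x [pick m | is_inf (cutting s) [set x; y] m].
Definition cutting_join x y := odflt x [pick m | is_sup (cutting s) [set x; y] m].

Lemma cutting_join_sup x y w : cutting s x w -> cutting s y w ->
  is_sup (cutting s) [set x; y] (cutting_join x y).
Proof.
move=> /cuttingP[J [K [bK upx]]] /cuttingP[J' [K' [bK' upy]]].
have [z upz] := upper_factor_exists (K :&: K') w.
rewrite /cutting_join; case: pickP => //= /(_ z).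
by rewrite (cutting_sup_upper bK bK' upx upy upz).
Qed.

Lemma cutting_meet_inf x y : is_inf (cutting s) [set x; y] (cutting_meet x y).
Proof.
have [|m infm] := bounded_sups_infs cutting_order cutting1 _ x y.
  by move=> u v w uw vw; exists (cutting_join u v); apply: cutting_join_sup uw vw.
by rewrite /cutting_meet; case: pickP => //= /(_ m); rewrite infm.
Qed.

Section TwoBlocksOperations.

Variables (J J' K K' : {set I}) (w u v z : gT).
Hypothesis blockK : W J = W K :^ w^-1.
Hypothesis blockK' : W J' = W K' :^ w^-1.
Hypothesis upu : is_upper_factor s K w u.
Hypothesis upv : is_upper_factor s K' w v.

Lemma cutting_meet_upper : is_upper_factor s (K :|: K') w z -> cutting_meet u v = z.
Proof.
move=> upz; apply: (is_inf_unique cutting_order (cutting_meet_inf u v)).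
exact: (cutting_inf_upper blockK blockK' upu upv upz).
Qed.

Lemma cutting_join_upper : is_upper_factor s (K :&: K') w z -> cutting_join u v = z.
Proof.
move=> upz; have uw : cutting s u w by apply/cuttingP; exists J, K.
have vw : cutting s v w by apply/cuttingP; exists J', K'.
apply: (is_sup2_unique cutting_order (cutting_join_sup uw vw)).
exact: (cutting_sup_upper blockK blockK' upu upv upz).
Qed.

End TwoBlocksOperations.

(** Below a common bound [w], meets and joins correspond to unions and intersections of blocks of
    [w], so both laws are inherited from sets. *)
Lemma cutting_locally_distributive :
  locally_distributive (cutting s) cutting_meet cutting_join.
Proof.
split; [exact: cutting_order | exact: cutting_meet_inf | exact: cutting_join_sup | |];
  move=> x1 x2 x3 w /cuttingP[J1 [K1 [b1 up1]]] /cuttingP[J2 [K2 [b2 up2]]]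
    /cuttingP[J3 [K3 [b3 up3]]].
- have [x23 up23] := upper_factor_exists (K2 :&: K3) w.
  have [x12 up12] := upper_factor_exists (K1 :|: K2) w.
  have [x13 up13] := upper_factor_exists (K1 :|: K3) w.
  have [y upy] := upper_factor_exists (K1 :|: (K2 :&: K3)) w.
  rewrite (cutting_join_upper b2 b3 up2 up3 up23).
  rewrite (cutting_meet_upper b1 (blockI b2 b3) up1 up23 upy).
  rewrite (cutting_meet_upper b1 b2 up1 up2 up12) (cutting_meet_upper b1 b3 up1 up3 up13).
  rewrite setUIr in upy.
  by rewrite (cutting_join_upper (blockU b1 b2) (blockU b1 b3) up12 up13 upy).
have [x23 up23] := upper_factor_exists (K2 :|: K3) w.
have [x12 up12] := upper_factor_exists (K1 :&: K2) w.
have [x13 up13] := upper_factor_exists (K1 :&: K3) w.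
have [y upy] := upper_factor_exists (K1 :&: (K2 :|: K3)) w.
rewrite (cutting_meet_upper b2 b3 up2 up3 up23).
rewrite (cutting_join_upper b1 (blockU b2 b3) up1 up23 upy).
rewrite (cutting_join_upper b1 b2 up1 up2 up12) (cutting_join_upper b1 b3 up1 up3 up13).
rewrite setIUr in upy.
by rewrite (cutting_meet_upper (blockI b1 b2) (blockI b1 b3) up12 up13 upy).
Qed.

Lemma weakR_bounded_lattice_operations :
  bounded_lattice_operations (cutting s) cutting_meet cutting_join (weakR s).
Proof.
split=> [|u v w]; first exact: weakR_order.
move=> /cuttingP[J [K [bK upu]]] /cuttingP[J' [K' [bK' upv]]].
have [m upm] := upper_factor_exists (K :|: K') w.
have [z upz] := upper_factor_exists (K :&: K') w.
rewrite (cutting_meet_upper bK bK' upu upv upm) (cutting_join_upper bK bK' upu upv upz).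
split; first exact: (weakR_inf_upper bK bK' upu upv upm).
exact: (weakR_sup_upper bK bK' upu upv upz).
Qed.

(* Inversion exchanges the two weak orders and preserves the cutting order. *)
Lemma weakL_bounded_lattice_operations :
  bounded_lattice_operations (cutting s) cutting_meet cutting_join (weakL s).
Proof.
split=> [|u v w uw vw]; first exact: weakL_order.
have [u'w v'w] : cutting s u^-1 w^-1 /\ cutting s v^-1 w^-1 by rewrite !cuttingV.
have [_ /(_ _ _ _ u'w v'w)[]] := weakR_bounded_lattice_operations.
have -> : cutting_meet u^-1 v^-1 = (cutting_meet u v)^-1.
  have /is_inf2P[mu mv glb] := cutting_meet_inf u v.
  apply: (is_inf_unique cutting_order (cutting_meet_inf _ _)).
  apply/is_inf2P; rewrite !cuttingV; split=> // z.
  by rewrite -(invgK z) !cuttingV; apply: glb.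
have -> : cutting_join u^-1 v^-1 = (cutting_join u v)^-1.
  have /is_sup2P[uj vj lub] := cutting_join_sup uw vw.
  apply: (is_sup2_unique cutting_order (cutting_join_sup u'w v'w)).
  apply/is_sup2P; rewrite !cuttingV; split=> // z.
  by rewrite -(invgK z) !cuttingV; apply: lub.
move=> /is_inf2P[mu mv glb] /is_sup2P[uj vj lub]; split.
  by apply/is_inf2P; rewrite !weakLV; split=> // z; rewrite !weakLV; apply: glb.
by apply/is_sup2P; rewrite !weakLV; split=> // z; rewrite !weakLV; apply: lub.
Qed.

End CoxeterSystem.

Theorem theorem3p41 (gT : finGroupType) (I : finType) (s : I -> gT)
    (hW : coxeter_system s) :
  [/\ (* (1) *)
      [/\ meet_semilattice (cutting s),
          meet_distributive (cutting s),
          (forall w : gT, cutting s 1%g w),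
          (forall v w : gT, cutting s v w -> weakL s v w) &
          (forall v w : gT, cutting s v w -> weakR s v w)],
      (* (2) *)
      (forall u w : gT, cutting s u w ->
        let X := order_interval (cutting s) u w in
        [/\ distributive_lattice_on (cutting s) X,
            sublattice (cutting s) (cutting s) X,
            sublattice (cutting s) (weakL s) X &
            sublattice (cutting s) (weakR s) X]),
      (* (3) *)
      (forall w : gT,
        let Pred := lower_covers (cutting s) w in
        let L := meet_span (cutting s) w Pred in
        [/\ L = meet_span (weakL s) w Pred,
            L = meet_span (weakR s) w Pred,
            free_meets (cutting s) w Pred &
            boolean_lattice_on (cutting s) L]) &
      (* (4) *)
      (forall u w : gT, cutting s u w ->
        let Pred := lower_covers (cutting s) w in
        moebius (cutting s) u w =
          if u \in meet_span (cutting s) w Pred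
          then ((-1) ^+ #|[set v in Pred | cutting s u v]|)%R
          else 0%R)].
Proof.
have ld := cutting_locally_distributive hW.
have opsR := weakR_bounded_lattice_operations hW.
have opsL := weakL_bounded_lattice_operations hW.
split.
- split.
  + exact: locally_distributive_meet_semilattice ld.
  + exact: locally_distributive_meet_distributive ld.
  + exact: cutting1.
  + exact: cutting_weakL.
  + exact: cutting_weakR.
- move=> u w _ X; split.
  + exact: (distributive_lattice_on_interval ld u w).
  + by split=> //; apply: meet_join_closed_interval ld u w.
  + exact: (compatible_order_sublattice ld opsL u w).
  + exact: (compatible_order_sublattice ld opsR u w).
- move=> w Pred L; split.
  + exact: (compatible_order_meet_span ld opsL w).
  + exact: (compatible_order_meet_span ld opsR w).
  + exact (@free_meets_coatoms _ _ _ _ ld w).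
  + exact: (boolean_meet_span_coatoms ld w).
by move=> u w uw; apply: moebius_coatoms ld _ _ uw.
Qed.
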